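(* For any uncountable cardinals $\kappa\le\lambda\le\mathfrak c$ the following are equivalent: (1) $C_9(\lambda,\kappa)$; (2) there exist a set $E\subseteq\mathbb R$ of cardinality $\lambda$, a non-$\sigma$-compact Polish space $Y$, and a continuous function $f:E\to Y$ which is not uniformly continuous (with respect to an arbitrary complete metric on $Y$ compatible with its topology) on any subset of $E$ of cardinality $\kappa$. Moreover, any $\kappa$-$K$-Lusin set $E$ of cardinality $\lambda$ in $\mathbb P$ has the property expressed in (2) with respect to any non-$\sigma$-compact Polish space $Y$; that is, for every non-$\sigma$-compact Polish space $Y$ there is a continuous function $f:E\to Y$ which is not uniformly continuous (with respect to an arbitrary complete metric on $Y$ compatible with its topology) on any subset of $E$ of cardinality $\kappa$.
   Context: $\mathfrak c=2^{\aleph_0}$. $\mathbb P$ is the set of irrational numbers in $I=[0,1]$. Subsets of $\mathbb R$ carry the Euclidean metric; a function is (not) uniformly continuous on a set $A$ if its restriction to $A$ is (not) uniformly continuous. $C_9(\lambda,\kappa)$ is the statement: there exists a set $E\subseteq\mathbb R$ of cardinality $\lambda$ (equivalently: for any set $E\subseteq\mathbb R$ of cardinality $\lambda$) there is a sequence of functions $f_n:E\to\mathbb R$ converging pointwise on $E$ but not converging uniformly on any subset of $E$ of cardinality $\kappa$. An uncountable subset $E$ of a Polish space $P$ is a $\kappa$-$K$-Lusin set in $P$ if $|E\cap K|<\kappa$ for every compact set $K\subseteq P$. *)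

(* Defs.v *)
From mathcomp Require Import all_boot all_order all_algebra.
From mathcomp Require Import all_classical all_reals all_analysis.

Set Implicit Arguments.
Unset Strict Implicit.
Unset Printing Implicit Defensive.

Import Order.TTheory GRing.Theory Num.Theory.
Import numFieldNormedType.Exports.

Local Open Scope classical_set_scope.
Local Open Scope ring_scope.
Local Open Scope card_scope.

(* A cardinal is represented by any set, of any type, having that cardinality;
   the continuum is represented by [set: nat -> bool]. *)

Definition card_lt {T U : Type} (A : set T) (B : set U) : Prop :=
  A #<= B /\ ~ (A #= B).

Record is_metric {R : realType} {Y : Type} (d : Y -> Y -> R) : Prop :=
  IsMetric {
    dist_ge0 : forall x y, 0 <= d x y ;
    dist_eq0 : forall x y, d x y = 0 <-> x = y ;
    dist_sym : forall x y, d x y = d y x ;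
    dist_triangle : forall x y z, d x z <= d x y + d y z }.

Definition compatible_metric {R : realType} {Y : topologicalType}
    (d : Y -> Y -> R) : Prop :=
  forall (y : Y) (A : set Y),
    nbhs y A <-> exists2 e : R, 0 < e & [set z | d y z < e] `<=` A.

Definition complete_metric {R : realType} {Y : Type} (d : Y -> Y -> R) : Prop :=
  forall u : nat -> Y,
    (forall e : R, 0 < e -> exists N : nat, forall m n : nat,
       (N <= m)%N -> (N <= n)%N -> d (u m) (u n) < e) ->
    exists y : Y, d (u n) y @[n --> \oo] --> (0 : R).

Definition complete_compatible_metric {R : realType} {Y : topologicalType}
    (d : Y -> Y -> R) : Prop :=
  [/\ is_metric d, compatible_metric d & complete_metric d].

Definition polish_space (R : realType) (Y : topologicalType) : Prop :=
  (exists d : Y -> Y -> R, complete_compatible_metric d) /\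
  (exists2 D : set Y, countable D & dense D).

Definition sigma_compact (Y : topologicalType) : Prop :=
  exists2 K : nat -> set Y,
    (forall n, compact (K n)) & \bigcup_n K n = [set: Y].

Definition unif_continuous_on {R : realType} {Y : Type} (d : Y -> Y -> R)
    (A : set R) (f : R -> Y) : Prop :=
  forall e : R, 0 < e -> exists2 delta : R, 0 < delta &
    forall x y : R, A x -> A y -> `|x - y| < delta -> d (f x) (f y) < e.

(* Functions on E are represented by total functions on R of which only the
   values on E matter. *)

Definition C9 (R : realType) {lT kT : Type} (lambda : set lT) (kappa : set kT)
    : Prop :=
  exists E : set R, E #= lambda /\
    exists f_ : nat -> R -> R,
      (forall x, E x -> cvg (f_ n x @[n --> \oo])) /\
      (forall A : set R, A `<=` E -> A #= kappa ->
         ~ exists g : R -> R, {uniform A, f_ @ \oo --> g}).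

Definition has_nowhere_unif_continuous_map {R : realType} {kT : Type}
    (kappa : set kT) (E : set R) (Y : topologicalType) : Prop :=
  exists f : R -> Y, {within E, continuous f} /\
    forall d : Y -> Y -> R, complete_compatible_metric d ->
    forall A : set R, A `<=` E -> A #= kappa -> ~ unif_continuous_on d A f.

Definition K_Lusin {kT : Type} (kappa : set kT) {P : topologicalType}
    (E : set P) : Prop :=
  ~ countable E /\ forall K : set P, compact K -> card_lt (E `&` K) kappa.

Definition unit_irrationals (R : realType) : set R :=
  `[0, 1] `&` @irrational R.

Arguments unit_irrationals R : clear implicits.

(* Main.v *)
Require Import Defs.
From HB Require Import structures.
From mathcomp Require Import all_boot all_order all_algebra.
From mathcomp Require Import all_classical all_reals all_analysis.
From mathcomp Require Import lra.
Import numFieldNormedType.Exports.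
Import Order.TTheory GRing.Theory Num.Theory.
Set Implicit Arguments.
Unset Strict Implicit.
Unset Printing Implicit Defensive.

(* Keeps [harmonic n] folded under simplification: linear arithmetic treats it
   as an atom. *)
Local Arguments harmonic : simpl never.

Local Open Scope classical_set_scope.
Local Open Scope ring_scope.
Local Open Scope card_scope.

(** The theorem is a comparison of three ways of being small for subsets of a
    set E of reals: uniform convergence of a pointwise convergent sequence,
    uniform continuity of a continuous map, and boundedness in the Baire space
    (pointwise domination of a family of elements of nat -> nat by one element).

    From a map to a sequence: if f : E -> Y is continuous, the truncated
    oscillation of f on the ball of radius 1/(n+1) around x, restricted to E,
    tends to 0 at each point x of E; where it does so uniformly, f is uniformly
    continuous ([uniform_local_oscillation_unif_continuous]).

    From boundedness to maps: a Polish space Y that is not sigma-compact contains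
    a closed copy of the Baire space, by Hurewicz. What is needed is slightly
    less: a uniformly continuous phi : (nat -> nat) -> Y such that if the images
    phi (u_j) form a Cauchy sequence, then each coordinate of u_j is eventually
    constant ([baire_closed_embedding]). It is built from a scheme of balls,
    whose centres have no neighbourhood inside a sigma-compact set, so that each
    ball contains infinitely many uniformly separated such centres.

    Now let psi : E -> (nat -> nat) be continuous, with E included in [0, 1]. If
    phi \o psi is uniformly continuous on A for some complete compatible metric,
    then psi is bounded on A: points of A at which a coordinate of psi tends to
    infinity would have a cluster point in [0, 1], hence yield a sequence with
    convergent images, along which that coordinate is eventually constant
    ([unif_continuous_bounded]). Hence if psi is unbounded on each subset of E of
    cardinality kappa, then phi \o psi is uniformly continuous on none of them
    ([nowhere_unif_continuous_of_unbounded]).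

    Two maps psi are used. On the irrationals of [0, 1], psi x k is the integer
    part of 1 / |x - q_k| for an enumeration q of the rationals; the points where
    psi is dominated by g lie in a compact set of irrationals, so a K-Lusin set
    meets them in fewer than kappa points ([K_Lusin_code_unbounded]). For a
    sequence of functions on E, psi is a modulus of pointwise convergence,
    so that the convergence is uniform on each set where psi is bounded. It need
    not be continuous on E, so E is replaced by an equipotent subset of a copy of
    the Cantor set, whose digits in base 3 record both the point of E and its
    modulus ([continuous_coding]). *)

(** * Real sequences and metrics *)

Section Metric.
Context {R : realType}.

Lemma ex_harmonic_lt (e : R) : 0 < e -> exists n : nat, @harmonic R n < e.
Proof. by move=> /ltr_add_invr[k]; rewrite add0r; exists k. Qed.

Lemma harmonic_le (m n : nat) : (m <= n)%N -> @harmonic R n <= @harmonic R m.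
Proof. by move=> mn; rewrite lef_pV2 ?posrE ?ltr0n// ler_nat. Qed.

Lemma ge0_cvg0P (u : nat -> R) : (forall n, 0 <= u n) ->
  u n @[n --> \oo] --> (0 : R) <->
  forall e, 0 < e -> exists N, forall n, (N <= n)%N -> u n < e.
Proof.
move=> u0; split => [/cvgrPdist_lt uc e e0|H].
  have [N _ HN] := uc e e0; exists N => n Nn.
  by have := HN n Nn; rewrite /= sub0r normrN ger0_norm.
apply/cvgrPdist_lt => e e0; have [N HN] := H e e0.
by exists N => // n /= Nn; rewrite sub0r normrN ger0_norm// HN.
Qed.

Lemma unit_segment_cluster (a : nat -> R) : (forall n, 0 <= a n <= 1) ->
  exists p : R, forall e, 0 < e ->
    forall N, exists2 n, (N <= n)%N & `|a n - p| < e.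
Proof.
move=> a01.
have [|p [_ clp]] := @segment_compact R 0 1 (a @ \oo) _.
  by exists 0 => // n _ /=; rewrite in_itv/= a01.
exists p => e e0 N.
have [||_ [[n Nn <-] an]] := clp [set a n | n in [set n | (N <= n)%N]] (ball p e).
- by exists N => // n /= Nn; exists n.
- exact: nbhsx_ballx.
by exists n => //; rewrite distrC.
Qed.

End Metric.

(** [u] is a Cauchy sequence for [d]. *)
Definition metric_cauchy {R : realType} {Y : Type} (d : Y -> Y -> R)
    (u : nat -> Y) : Prop :=
  forall e : R, 0 < e -> exists N : nat, forall m n : nat,
    (N <= m)%N -> (N <= n)%N -> d (u m) (u n) < e.

(** * Subsets of sigma-compact sets *)

Section SigmaBounded.
Context {Y : topologicalType}.

(** [A] is contained in a countable union of compact sets. *)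
Definition sigma_bounded (A : set Y) :=
  exists2 K : nat -> set Y, (forall n, compact (K n)) & A `<=` \bigcup_n K n.

Lemma sigma_bounded_sub (A B : set Y) :
  A `<=` B -> sigma_bounded B -> sigma_bounded A.
Proof. by move=> AB [K Kc BK]; exists K => //; exact: subset_trans BK. Qed.

Lemma sigma_bounded_compact (A : set Y) : compact A -> sigma_bounded A.
Proof. by move=> cA; exists (fun=> A) => // y Ay; exists 0. Qed.

Lemma sigma_bounded_bigcup (A : nat -> set Y) :
  (forall n, sigma_bounded (A n)) -> sigma_bounded (\bigcup_n A n).
Proof.
move=> /(_ _)/cid2-/all_sig2[K Kc AK].
exists (fun i =>
  if @unpickle (nat * nat)%type i is Some nm then K nm.1 nm.2 else set0).
  by move=> i; case: unpickle => [[]|] //=; exact: compact0.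
move=> y [n _ /AK[m _ Ky]]; exists (pickle (n, m)) => //.
by rewrite pickleK.
Qed.

Lemma sigma_bounded_bigcup_countable (D : set Y) (A : Y -> set Y) :
  countable D -> (forall q, D q -> sigma_bounded (A q)) ->
  sigma_bounded (\bigcup_(q in D) A q).
Proof.
move=> /pcard_injP[f finj] sA.
apply: (@sigma_bounded_sub _
  (\bigcup_n [set z | exists q, [/\ D q, f q = n & A q z]])).
  by move=> z [q Dq Aqz]; exists (f q) => //; exists q.
apply: sigma_bounded_bigcup => n.
have [[q [Dq fq]]|nq] := pselect (exists q, D q /\ f q = n).
  apply: sigma_bounded_sub (sA q Dq) => z [q' [Dq' fq' Az]].
  by have -> : q = q' by apply: finj; rewrite ?inE// fq.
apply: sigma_bounded_sub (sigma_bounded_compact compact0) => z [q [Dq fq _]].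
by apply: nq; exists q.
Qed.

End SigmaBounded.

(** * Complete compatible metrics *)

Section CompleteMetric.
Context {R : realType} {Y : topologicalType} (d : Y -> Y -> R).
Hypothesis cd : complete_compatible_metric d.

Let dge0 x y : 0 <= d x y. Proof. by case: cd => -[]. Qed.
Let dC x y : d x y = d y x. Proof. by case: cd => -[]. Qed.
Let dtri y x z : d x z <= d x y + d y z. Proof. by case: cd => -[]. Qed.
Let dxx x : d x x = 0. Proof. by case: cd => -[_ H _ _] _ _; apply/H. Qed.

Lemma nbhs_metricP y (A : set Y) :
  nbhs y A <-> exists2 e, 0 < e & [set z | d y z < e] `<=` A.
Proof. by case: cd => _ + _; apply. Qed.

Lemma metric_complete (u : nat -> Y) : metric_cauchy d u ->
  exists y, forall e, 0 < e -> exists N, forall n, (N <= n)%N -> d (u n) y < e.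
Proof.
move=> uC; case: cd => _ _ /(_ u uC)[y uy]; exists y.
exact: ((ge0_cvg0P (fun n => dge0 (u n) y)).1 uy).
Qed.

(** An ultrafilter containing a finite union contains one of its members. *)
Lemma ultra_finite_cover (F : set_system Y) (P : Y -> set Y) (s : seq Y) :
  UltraFilter F -> F [set z | exists2 c, c \in s & P c z] -> exists c, F (P c).
Proof.
move=> FU; elim: s => [|c s IH] Fs.
  by exfalso; apply: (@filter_not_empty _ F); apply: filterS Fs => z [].
have [|Fc] := in_ultra_setVsetC (P c) FU; first by exists c.
apply: IH; apply: filterS (filterI Fs Fc) => z [[c' + Pz] nPz].
rewrite inE => /orP[/eqP cc'|c's]; first by case: nPz; rewrite -cc'.
by exists c'.
Qed.

(** Completeness for the arbitrary compatible metric [d]: an ultrafilter on [C]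
    contains a ball of each radius 1/(n+1), and the centres of these balls form a
    Cauchy sequence. *)
Lemma totally_bounded_compact (C : set Y) :
  (forall y, (forall e, 0 < e -> exists2 z, C z & d y z < e) -> C y) ->
  (forall e, 0 < e ->
    exists s : seq Y, forall z, C z -> exists2 c, c \in s & d c z < e) ->
  compact C.
Proof.
move=> Ccl Ctb; rewrite compact_ultra => F FU FC.
have /choice[c Fc] : forall n : nat, exists c, F [set z | d c z < @harmonic R n].
  move=> n; have n0 : 0 < @harmonic R n by exact: harmonic_gt0.
  have [s sC] := Ctb _ n0.
  apply: (@ultra_finite_cover F (fun c => [set z | d c z < @harmonic R n]) s).
  exact: filterS FC.
have [|y cy] := @metric_complete c.
  (* Two balls of [F] meet, so their centres are close. *)
  move=> e e0; have e20 : 0 < e / 2 by lra.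
  have [N Ne] := ex_harmonic_lt e20; exists N => m n Nm Nn.
  have [z [/= zm zn]] := filter_ex (filterI (Fc m) (Fc n)).
  have := dtri z (c m) (c n); rewrite (dC z).
  have := @harmonic_le R _ _ Nm; have := @harmonic_le R _ _ Nn; lra.
have Fy e : 0 < e -> F [set z | d y z < e].
  move=> e0; have e20 : 0 < e / 2 by lra.
  have [N Ne] := ex_harmonic_lt e20; have [M HM] := cy _ e20.
  apply: filterS (Fc (maxn N M)) => z /= zc.
  have := HM _ (leq_maxr N M); have := @harmonic_le R _ _ (leq_maxl N M).
  have := dtri (c (maxn N M)) y z; rewrite (dC y (c _)); lra.
exists y; split; last first.
  by move=> A /nbhs_metricP[e e0 eA]; exact: filterS (Fy e e0).
apply: Ccl => e e0; have [z [/= ? ?]] := filter_ex (filterI FC (Fy e e0)).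
by exists z.
Qed.

Lemma noncompact_separated_sequence (C : set Y) :
  (forall y, (forall e, 0 < e -> exists2 z, C z & d y z < e) -> C y) ->
  ~ compact C ->
  exists2 e, 0 < e & exists2 z : nat -> Y, (forall n, C (z n)) &
    forall m n, m <> n -> e <= d (z m) (z n).
Proof.
move=> Ccl ncC; apply: contrapT => nsep; apply: ncC.
apply: totally_bounded_compact => // e e0; apply: contrapT => nnet.
apply: nsep; exists e => //.
have /choice[p Hp] : forall s : seq Y,
    exists z, C z /\ forall c, c \in s -> e <= d c z.
  move=> s; apply: contrapT => ns; apply: nnet; exists s => z Cz.
  apply: contrapT => nz; apply: ns; exists z; split=> // c cs.
  by rewrite leNgt; apply/negP => cz; apply: nz; exists c.
(* [l n] lists, latest first, the first [n] terms of the sequence; the next term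
   [p (l n)] is [e]-far from all of them. *)
pose l := fix l n := if n is n'.+1 then p (l n') :: l n' else [::].
have lP m n : (m < n)%N -> p (l m) \in l n.
  elim: n => // n IH; rewrite ltnS leq_eqVlt => /orP[/eqP->|/IH mn].
    by rewrite /= mem_head.
  by rewrite /= inE mn orbT.
exists (fun n => p (l n)) => [n|]; first by case: (Hp (l n)).
move=> m n mn; have [mn'|nm|//] := ltngtP m n.
  by case: (Hp (l n)) => _; apply; exact: lP.
by rewrite dC; case: (Hp (l m)) => _; apply; exact: lP.
Qed.

(** * Closed copies of the Baire space *)

Lemma dense_metric (D : set Y) y e :
  dense D -> 0 < e -> exists2 q, D q & d y q < e.
Proof.
move=> dD e0.
have [||q [/interior_subset/= yq Dq]] := dD (interior [set z | d y z < e]).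
- by exists y; apply/nbhs_metricP; exists e.
- exact: open_interior.
by exists q.
Qed.

(** The points no neighbourhood of which is contained in a sigma-compact set. *)
Definition nowhere_sigma_bounded : set Y :=
  [set y | forall r, 0 < r -> ~ sigma_bounded [set z | d y z < r]].

(** The complement of the kernel [nowhere_sigma_bounded] is covered by countably
    many balls with centres in [D] and radii 1/(n+1), each contained in a
    sigma-compact set. *)
Lemma sigma_bounded_outside_kernel (D : set Y) : countable D -> dense D ->
  sigma_bounded (~` nowhere_sigma_bounded).
Proof.
move=> cD dD.
apply: (@sigma_bounded_sub _ _ (\bigcup_(q in D) \bigcup_n [set z |
   sigma_bounded [set z | d q z < @harmonic R n] /\ d q z < @harmonic R n])).
  move=> y /existsNP[r /not_implyP[r0 /contrapT sr]].
  have r20 : 0 < r / 2 by lra.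
  have [n nr] := ex_harmonic_lt r20.
  have [q Dq yq] := dense_metric y dD (harmonic_gt0 n : 0 < @harmonic R n).
  exists q => //; exists n => //=; rewrite dC; split=> //.
  apply: sigma_bounded_sub sr => z /= qz.
  have := dtri q y z; lra.
apply: sigma_bounded_bigcup_countable => // q Dq; apply: sigma_bounded_bigcup => n.
have [s|ns] := pselect (sigma_bounded [set z | d q z < @harmonic R n]).
  by apply: sigma_bounded_sub s => z [].
by apply: sigma_bounded_sub (sigma_bounded_compact compact0) => z [].
Qed.

(** The kernel [nowhere_sigma_bounded] meets the closed ball around any of its
    points in a non-compact set: otherwise the open ball would be included in the
    union of this compact set and the complement of the kernel, hence in a
    sigma-compact set. *)
Lemma nowhere_sigma_bounded_separated (D : set Y) (y : Y) (r : R) :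
  countable D -> dense D -> nowhere_sigma_bounded y -> 0 < r ->
  exists2 e, 0 < e & exists2 z : nat -> Y,
    (forall n, nowhere_sigma_bounded (z n) /\ d y (z n) <= r) &
    forall m n, m <> n -> e <= d (z m) (z n).
Proof.
move=> cD dD Py r0.
apply: (noncompact_separated_sequence
  (C := [set z | nowhere_sigma_bounded z /\ d y z <= r])).
- move=> z zC; split.
    move=> e e0 se; have e20 : 0 < e / 2 by lra.
    have [z' [/(_ _ e20) Pz' _] zz'] := zC _ e20.
    apply: Pz'; apply: sigma_bounded_sub se => w /= wz'.
    have := dtri z' z w; lra.
  rewrite leNgt; apply/negP => rz.
  have [|z' [_ yz'] zz'] := zC (d y z - r); first by lra.
  have := dtri z' y z; rewrite (dC z' z); lra.
- move=> /sigma_bounded_compact sC; apply: (Py r r0).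
  apply: (@sigma_bounded_sub _ _ (\bigcup_n if n is 0 then
    [set z | nowhere_sigma_bounded z /\ d y z <= r] else ~` nowhere_sigma_bounded)).
    move=> z /= yz; have [Pz|nPz] := pselect (nowhere_sigma_bounded z).
      by exists 0 => //=; split=> //; exact: ltW.
    by exists 1.
  by apply: sigma_bounded_bigcup => -[|n] //; exact: (sigma_bounded_outside_kernel cD).
Qed.

Lemma nowhere_sigma_bounded_nonempty (D : set Y) :
  countable D -> dense D -> ~ sigma_compact Y ->
  exists y, nowhere_sigma_bounded y.
Proof.
move=> cD dD nsY; apply: contrapT => nP; apply: nsY.
have [K cK sK] := sigma_bounded_outside_kernel cD dD.
exists K => //; apply/seteqP; split=> // y _; apply: sK => Py.
by apply: nP; exists y.
Qed.

Section BallScheme.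
(* From a point [y] of the kernel and a radius [r] come an infinite sequence
   [z y r] of points of the kernel near [y], and a distance [e y r] by which they
   are separated. *)
Variables (y0 : Y) (z : Y -> R -> nat -> Y) (e : Y -> R -> R).
Hypothesis Py0 : nowhere_sigma_bounded y0.
Hypothesis e_gt0 : forall y r, nowhere_sigma_bounded y -> 0 < r -> 0 < e y r.
Hypothesis z_small : forall y r n, nowhere_sigma_bounded y -> 0 < r ->
  nowhere_sigma_bounded (z y r n).
Hypothesis z_near : forall y r n, nowhere_sigma_bounded y -> 0 < r ->
  d y (z y r n) <= r / 2.
Hypothesis z_sep : forall y r m n, nowhere_sigma_bounded y -> 0 < r -> m <> n ->
  e y r <= d (z y r m) (z y r n).

(** Centre and radius of the ball attached to the prefix of length [k] of [x]. The
    bound [r / 2] on the next radius nests the balls, and [e y r / 4] keeps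
    sibling balls at distance at least [e y r / 2]. *)
Fixpoint ball_scheme (x : nat -> nat) (k : nat) : Y * R :=
  if k is k'.+1 then
    let: (y, r) := ball_scheme x k' in
    (z y r (x k'), Num.min (r / 2) (e y r / 4))
  else (y0, 1).

Local Notation ctr x k := (ball_scheme x k).1.
Local Notation rad x k := (ball_scheme x k).2.

Lemma ball_scheme_ext x x' k : (forall i, (i < k)%N -> x i = x' i) ->
  ball_scheme x k = ball_scheme x' k.
Proof.
elim: k => //= k IH H; rewrite IH; last by move=> i ik; apply/H/ltnW.
by rewrite H.
Qed.

Lemma ctrS x k : ctr x k.+1 = z (ctr x k) (rad x k) (x k).
Proof. by rewrite /=; case: ball_scheme. Qed.

Lemma radS x k : rad x k.+1 = Num.min (rad x k / 2) (e (ctr x k) (rad x k) / 4).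
Proof. by rewrite /=; case: ball_scheme. Qed.

Lemma ball_scheme_wf x k : nowhere_sigma_bounded (ctr x k) /\ 0 < rad x k.
Proof.
elim: k => [|k [Pk rk]]; first by split => //=.
rewrite ctrS radS; split; first exact: z_small.
rewrite lt_min; have ek := e_gt0 Pk rk; apply/andP; split; lra.
Qed.

Lemma rad_half x k : rad x k.+1 <= rad x k / 2.
Proof. by rewrite radS ge_min lexx. Qed.

Lemma rad_le x k : rad x k <= @harmonic R k.
Proof.
elim: k => [|k IH]; first by rewrite /harmonic /= invr1.
apply: le_trans (rad_half x k) _.
apply: (@le_trans _ _ (@harmonic R k / 2)); first by lra.
rewrite /harmonic -invfM lef_pV2 ?posrE ?mulr_gt0 ?ltr0n// -natrM ler_nat.
by rewrite muln2 -addnn addSnnS leq_addl.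
Qed.

Lemma ctr_dist x j k : d (ctr x k) (ctr x (k + j)) <= rad x k.
Proof.
elim: j k => [|j IH] k.
  by rewrite addn0 dxx; have [_ /ltW] := ball_scheme_wf x k.
rewrite addnS -addSn; have := IH k.+1; have := rad_half x k.
have [Pk rk] := ball_scheme_wf x k.
have := z_near (x k) Pk rk; rewrite -ctrS.
have := dtri (ctr x k.+1) (ctr x k) (ctr x (k.+1 + j)); lra.
Qed.

Lemma ball_scheme_limit x : exists y, forall k, d (ctr x k) y <= rad x k.
Proof.
have [|y cy] := @metric_complete (fun k => ctr x k).
  move=> t t0; have t20 : 0 < t / 2 by lra.
  have [N Nt] := ex_harmonic_lt t20; exists N => m n Nm Nn.
  have := ctr_dist x (m - N) N; have := ctr_dist x (n - N) N.
  rewrite !subnKC//; have := rad_le x N.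
  have := dtri (ctr x N) (ctr x m) (ctr x n).
  rewrite (dC (ctr x m) (ctr x N)); lra.
exists y => k; rewrite leNgt; apply/negP => ky.
have [|N HN] := cy (d (ctr x k) y - rad x k); first by lra.
have := HN (k + N)%N (leq_addl _ _).
have := ctr_dist x N k; have := dtri (ctr x (k + N)) (ctr x k) y; lra.
Qed.

(** Points of the balls attached to two sequences that first differ at [k] are at
    a distance bounded below in terms of the common prefix. *)
Lemma ball_scheme_separated x k : exists2 t, 0 < t &
  forall x' x'' y' y'',
    (forall i, (i < k)%N -> x' i = x i) ->
    (forall i, (i < k)%N -> x'' i = x i) -> x' k <> x'' k ->
    d (ctr x' k.+1) y' <= rad x' k.+1 -> d (ctr x'' k.+1) y'' <= rad x'' k.+1 ->
    t <= d y' y''.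
Proof.
have [Pk rk] := ball_scheme_wf x k; have ek := e_gt0 Pk rk.
exists (e (ctr x k) (rad x k) / 2); first by lra.
move=> x' x'' y' y'' /ball_scheme_ext ex' /ball_scheme_ext ex'' neq.
rewrite !ctrS !radS ex' ex'' !le_min => /andP[_ xy'] /andP[_ xy''].
have := z_sep Pk rk neq.
set a' := z _ _ (x' k) in xy' *; set a'' := z _ _ (x'' k) in xy'' *.
have := dtri y' a' a''; have := dtri y'' y' a''; rewrite (dC y'' a''); lra.
Qed.

End BallScheme.

End CompleteMetric.

(** Hurewicz: the Baire space embeds as a closed subspace of every Polish space
    that is not sigma-compact. The second property of [phi] expresses injectivity,
    continuity of the inverse and closedness of the image at once. *)
Theorem baire_closed_embedding {R : realType} {Y : topologicalType}
    (d : Y -> Y -> R) (D : set Y) :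
  complete_compatible_metric d -> countable D -> dense D -> ~ sigma_compact Y ->
  exists phi : (nat -> nat) -> Y,
    (forall e, 0 < e -> exists k, forall x x',
      (forall i, (i < k)%N -> x i = x' i) -> d (phi x) (phi x') < e) /\
    (forall u : nat -> nat -> nat, metric_cauchy d (phi \o u) ->
      forall k, exists N, forall m n, (N <= m)%N -> (N <= n)%N -> u m k = u n k).
Proof.
move=> cd cD dD nsY.
have dC x y : d x y = d y x by case: cd => -[].
have dtri y x z : d x z <= d x y + d y z by case: cd => -[].
have [y0 Py0] := nowhere_sigma_bounded_nonempty cd cD dD nsY.
have /choice[g Hg] : forall yr : Y * R, exists p : R * (nat -> Y),
    nowhere_sigma_bounded d yr.1 -> 0 < yr.2 -> [/\ 0 < p.1,
      forall n, nowhere_sigma_bounded d (p.2 n) /\ d yr.1 (p.2 n) <= yr.2 / 2 &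
      forall m n, m <> n -> p.1 <= d (p.2 m) (p.2 n)].
  move=> [y r] /=.
  have [[Py r0]|nPr] := pselect (nowhere_sigma_bounded d y /\ 0 < r); last first.
    by exists (1, fun=> y) => Py r0; case: nPr.
  have r20 : 0 < r / 2 by lra.
  have [e e0 [z Pz zs]] := nowhere_sigma_bounded_separated cd cD dD Py r20.
  by exists (e, z).
pose e y r := (g (y, r)).1; pose z y r := (g (y, r)).2.
have e_gt0 y r : nowhere_sigma_bounded d y -> 0 < r -> 0 < e y r.
  by move=> Py r0; case: (Hg (y, r) Py r0).
have z_small y r n : nowhere_sigma_bounded d y -> 0 < r ->
    nowhere_sigma_bounded d (z y r n).
  by move=> Py r0; case: (Hg (y, r) Py r0) => _ /(_ n)[].
have z_near y r n : nowhere_sigma_bounded d y -> 0 < r -> d y (z y r n) <= r / 2.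
  by move=> Py r0; case: (Hg (y, r) Py r0) => _ /(_ n)[].
have z_sep y r m n : nowhere_sigma_bounded d y -> 0 < r -> m <> n ->
    e y r <= d (z y r m) (z y r n).
  by move=> Py r0; case: (Hg (y, r) Py r0) => _ _; apply.
have /choice[phi Hphi] := ball_scheme_limit cd Py0 e_gt0 z_small z_near.
exists phi; split=> [t t0|u uC].
  have t20 : 0 < t / 2 by lra.
  have [k kt] := ex_harmonic_lt t20; exists k => x x' xx'.
  have := Hphi x k; have := Hphi x' k; rewrite (ball_scheme_ext y0 z e xx').
  have := rad_le y0 z e x' k.
  set c := (ball_scheme _ _ _ _ _).1.
  have := dtri c (phi x) (phi x'); rewrite (dC _ c); lra.
(* Once the coordinates below [k] are constant, all the balls concerned are
   siblings, and close points must lie in the same one. *)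
elim/ltn_ind => k IH.
have [N HN] : exists N, forall i, (i < k)%N ->
    forall m n, (N <= m)%N -> (N <= n)%N -> u m i = u n i.
  elim: k IH => [|k IHk] IH; first by exists 0.
  have [|N HN] := IHk; first by move=> i ik; apply/IH/ltnW.
  have [M HM] := IH k (ltnSn k); exists (maxn N M) => i.
  rewrite ltnS leq_eqVlt => /orP[/eqP->|ik] m n; rewrite !geq_max.
    by move=> /andP[_ Mm] /andP[_ Mn]; exact: HM.
  by move=> /andP[Nm _] /andP[Nn _]; exact: HN.
have [t t0 Ht] := ball_scheme_separated cd Py0 e_gt0 z_small z_sep (u N) k.
have [M HM] := uC t t0.
exists (maxn N M) => m n; rewrite !geq_max => /andP[Nm Mm] /andP[Nn Mn].
apply: contrapT => neq; have := HM m n Mm Mn; rewrite ltNge => /negP; apply.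
by apply: (Ht (u m) (u n)) => // i ik; exact: HN.
Qed.

(** * Uniform continuity and boundedness *)

(** Continuity on [E] of [psi], as a map into the product of countably many copies
    of the discrete space [nat]. *)
Definition coordinatewise_locally_constant {R : realType} (E : set R)
    (psi : R -> nat -> nat) : Prop :=
  forall x k, E x -> exists2 delta : R, 0 < delta &
    forall y, E y -> `|x - y| < delta -> psi y k = psi x k.

Lemma locally_constant_prefix {R : realType} (E : set R) psi :
  coordinatewise_locally_constant E psi ->
  forall x k, E x -> exists2 delta : R, 0 < delta &
    forall y, E y -> `|x - y| < delta -> forall i, (i < k)%N -> psi y i = psi x i.
Proof.
move=> lc x k Ex; elim: k => [|k [e e0 He]]; first by exists 1.
have [t t0 Ht] := lc x k Ex; exists (Num.min e t); first by rewrite lt_min e0.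
move=> y Ey; rewrite lt_min => /andP[xye xyt] i.
by rewrite ltnS leq_eqVlt => /orP[/eqP->|ik]; [exact: Ht | exact: He].
Qed.

(** The values of [psi] on [A] are dominated pointwise by a single sequence. *)
Definition bounded_on {T : Type} (psi : T -> nat -> nat) (A : set T) : Prop :=
  exists g : nat -> nat, forall x k, A x -> (psi x k <= g k)%N.

(** The metric [d0], for which [phi] reflects Cauchy sequences, need not be the
    metric [d] of the uniform continuity: the two share their convergent
    sequences, and [d] is complete. *)
Lemma unif_continuous_bounded {R : realType} {Y : topologicalType}
    (d0 d : Y -> Y -> R) (phi : (nat -> nat) -> Y) (psi : R -> nat -> nat)
    (A : set R) :
  complete_compatible_metric d0 -> complete_compatible_metric d ->
  (forall u : nat -> nat -> nat, metric_cauchy d0 (phi \o u) ->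
     forall k, exists N, forall m n, (N <= m)%N -> (N <= n)%N -> u m k = u n k) ->
  A `<=` `[0, 1] -> unif_continuous_on d A (phi \o psi) -> bounded_on psi A.
Proof.
move=> cd0 cd Hphi A01 ufA; apply: contrapT => nb.
have d0C x y : d0 x y = d0 y x by case: cd0 => -[].
have d0tri y x z : d0 x z <= d0 x y + d0 y z by case: cd0 => -[].
have dC x y : d x y = d y x by case: cd => -[].
have [k nk] : exists k, forall b, exists2 x, A x & (b < psi x k)%N.
  apply: contrapT => nk; apply: nb.
  have /choice[g Hg] : forall k, exists b, forall x, A x -> (psi x k <= b)%N.
    move=> k; apply: contrapT => nb; apply: nk; exists k => b.
    apply: contrapT => nx; apply: nb; exists b => x Ax.
    by rewrite leqNgt; apply/negP => bx; apply: nx; exists x.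
  by exists g => x j; exact: Hg.
have /choice[a Ha] : forall b, exists x, A x /\ (b < psi x k)%N.
  by move=> b; have [x] := nk b; exists x.
have [|p ap] := @unit_segment_cluster R a.
  by move=> n; have [/A01] := Ha n; rewrite /= in_itv.
have /choice[s Hs] : forall j, exists n, (j <= n)%N /\ `|a n - p| < @harmonic R j.
  by move=> j; have [n] := ap _ (harmonic_gt0 j : 0 < @harmonic R j) j; exists n.
have [y yP] : exists y, forall e, 0 < e -> exists N, forall n, (N <= n)%N ->
    d (phi (psi (a (s n)))) y < e.
  apply: (metric_complete cd (u := fun n => phi (psi (a (s n))))) => e e0.
  have [t t0 Ht] := ufA e e0; have t20 : 0 < t / 2 by lra.
  have [N Nt] := ex_harmonic_lt t20; exists N => m n Nm Nn.
  apply: Ht; [by case: (Ha (s m))|by case: (Ha (s n))|].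
  have [_ sm] := Hs m; have [_ sn] := Hs n.
  have := harmonic_le (R := R) Nm; have := harmonic_le (R := R) Nn.
  have := ler_distD p (a (s m)) (a (s n)); rewrite (distrC p); lra.
have [|N HN] := Hphi (fun n => psi (a (s n))) _ k.
  move=> e e0; have e20 : 0 < e / 2 by lra.
  have : nbhs y [set z | d0 y z < e / 2].
    by apply/(nbhs_metricP cd0); exists (e / 2).
  move=> /(nbhs_metricP cd)[t t0 Ht]; have [N HN] := yP t t0; exists N => m n Nm Nn.
  have ym : d0 y (phi (psi (a (s m)))) < e / 2.
    by apply: Ht; rewrite /= dC; exact: HN.
  have yn : d0 y (phi (psi (a (s n)))) < e / 2.
    by apply: Ht; rewrite /= dC; exact: HN.
  rewrite /=; have := d0tri y (phi (psi (a (s m)))) (phi (psi (a (s n)))).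
  rewrite (d0C _ y); lra.
(* The [k]-th coordinate of [psi (a (s n))] exceeds [n], yet it is constant from
   [N] on. *)
pose b := psi (a (s N)) k.
have := HN N (maxn N b) (leqnn _) (leq_maxl _ _).
have [_] := Ha (s (maxn N b)); have [+ _] := Hs (maxn N b) => /= bs.
rewrite -/b => + eb; rewrite -eb ltnNge (leq_trans (leq_maxr N b) bs)//.
Qed.

Lemma nowhere_unif_continuous_of_unbounded {R : realType} {kT : Type}
    (kappa : set kT) (E : set R) (psi : R -> nat -> nat) (Y : topologicalType) :
  E `<=` `[0, 1] -> coordinatewise_locally_constant E psi ->
  (forall A, A `<=` E -> A #= kappa -> ~ bounded_on psi A) ->
  polish_space R Y -> ~ sigma_compact Y ->
  has_nowhere_unif_continuous_map kappa E Y.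
Proof.
move=> E01 lc nb [[d0 cd0] [D cD dD]] nsY.
have [phi [phic phiN]] := baire_closed_embedding cd0 cD dD nsY.
exists (phi \o psi); split; last first.
  move=> d cd A AE Ak uc; apply: (nb A AE Ak).
  exact: (unif_continuous_bounded cd0 cd phiN (subset_trans AE E01)).
apply/subspace_continuousP => x Ex B /(nbhs_metricP cd0)[e e0 eB].
have [k Hk] := phic e e0; have [t t0 Ht] := locally_constant_prefix lc k Ex.
apply/nbhs_ballP; exists t => // y /= xy Ey; apply: eB => /=.
by apply: Hk => i ik; rewrite Ht.
Qed.

(** * Coding irrational numbers *)

Section Irrationals.
Context {R : realType}.

(** An enumeration of the rationals, with value 0 at the indices that code no
    rational. *)
Definition rational_enum (k : nat) : R :=
  if @unpickle rat k is Some r then ratr r else 0.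

Lemma rational_enumP (x : R) : rational x <-> exists k, x = rational_enum k.
Proof.
split=> [[r _ <-]|[k ->]].
  by exists (pickle r); rewrite /rational_enum pickleK.
rewrite /rational_enum; case: unpickle => [r|]; first by exists r.
by exists 0 => //; rewrite rmorph0.
Qed.

(** The [k]-th coordinate is large exactly when [x] is close to the [k]-th
    rational. *)
Definition irrational_code (x : R) (k : nat) : nat :=
  Num.trunc (`|x - rational_enum k|^-1).

(** For [n = 0] this says that [x] differs from the [k]-th rational, since the
    inverse of 0 is 0. *)
Lemma irrational_inv_dist_neq (x : R) k (n : nat) : irrational x ->
  `|x - rational_enum k|^-1 != n%:R.
Proof.
move=> ix; apply/eqP => xn; apply: ix.
have [r rk] : exists r, rational_enum k = ratr r.
  have [_ /(_ (ex_intro _ k erefl))[r _ <-]] := rational_enumP (rational_enum k).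
  by exists r.
have {}xn : `|x - ratr r| = ratr n%:R^-1.
  by rewrite -rk -[LHS]invrK xn fmorphV rmorph_nat.
have [xr|xr] := leP (ratr r) x.
  exists (r + n%:R^-1) => //; rewrite rmorphD /= -xn ger0_norm ?subr_ge0//.
  by rewrite addrC subrK.
exists (r - n%:R^-1) => //; rewrite rmorphB /= -xn ltr0_norm ?subr_lt0//.
by rewrite opprK addrC subrK.
Qed.

Lemma irrational_code_locally_constant (E : set R) : E `<=` irrational ->
  coordinatewise_locally_constant E irrational_code.
Proof.
move=> Ei x k Ex; have ix := Ei _ Ex.
pose v y := `|y - rational_enum k|^-1.
have v0 y : 0 <= v y by rewrite invr_ge0.
have xq : `|x - rational_enum k| != 0.
  apply/eqP => xq; have := irrational_inv_dist_neq k 0%N ix.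
  by rewrite xq invr0 eqxx.
have /andP[v1 v2] := truncn_itv (v0 x).
have v1' : (irrational_code x k)%:R < v x.
  by rewrite lt_neqAle v1 andbT eq_sym irrational_inv_dist_neq.
have vc : v y @[y --> x] --> v x.
  by apply: cvgV => //; apply: cvg_norm; apply: cvgB => //; exact: cvg_cst.
have /nbhs_ballP[t t0 Ht] : \forall y \near x,
    (irrational_code x k)%:R < v y < (irrational_code x k).+1%:R.
  near=> y; apply/andP; split.
  - by near: y; apply: cvgr_gt vc _ v1'.
  - by near: y; apply: cvgr_lt vc _ v2.
exists t => // y Ey xy; have /andP[y1 y2] := Ht _ xy.
by apply: truncn_def; rewrite (ltW y1) y2.
Unshelve. all: by end_near. Qed.

Lemma irrational_code_bounded_compact (g : nat -> nat) :
  exists2 K : set R, compact K & K `<=` unit_irrationals R /\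
    forall x, unit_irrationals R x ->
      (forall k, irrational_code x k <= g k)%N -> K x.
Proof.
exists (`[0, 1] `&` \bigcap_k
    [set x | 1 <= (g k).+1%:R * `|x - rational_enum k|]).
  apply: compact_closedI; first exact: segment_compact.
  apply: closed_bigI => k _.
  apply: (@preimage_closed _ _
    (fun x => (g k).+1%:R * `|x - rational_enum k|) [set y | 1 <= y]).
    move=> x _; apply: cvgM; first exact: cvg_cst.
    by apply: cvg_norm; apply: cvgB => //; exact: cvg_cst.
  exact: closed_ge.
split=> [x [x01 xK]|x [x01 ix] xg]; split=> //.
- move=> /rational_enumP[k xk]; have := xK k I.
  by rewrite /= xk subrr normr0 mulr0 ler10.
- move=> k _ /=.
  have v0 : 0 <= `|x - rational_enum k|^-1 by rewrite invr_ge0.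
  have xq : 0 < `|x - rational_enum k|.
    rewrite lt_neqAle normr_ge0 andbT eq_sym; apply/eqP => xq.
    by have := irrational_inv_dist_neq k 0%N ix; rewrite xq invr0 eqxx.
  rewrite -ler_pdivrMr// div1r; have /andP[_ /ltW v2] := truncn_itv v0.
  by apply: le_trans v2 _; rewrite ler_nat ltnS; exact: xg.
Qed.

Lemma compact_preimage_set_val (P K : set R) : compact K -> K `<=` P ->
  compact (set_val @^-1` K : set (set_type P)).
Proof.
move=> cK KP F PF FK.
have [p [Kp clp]] := cK (set_val @ F) _ FK.
exists (SigSub (mem_set (KP p Kp))); split => //.
move=> A B FA [_ [[B' oB' <-] B'p sB'B]].
have [||q [[y Ay <-] B'y]] := clp (set_val @` A) B'.
- by apply: (@filterS _ F _ _ _ _ FA) => y Ay; exists y.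
- exact: open_nbhs_nbhs.
- by exists y; split => //; exact: sB'B.
Qed.

Lemma K_Lusin_code_unbounded {kT : Type} (kappa : set kT)
    (E : set (set_type (unit_irrationals R))) (A : set R) :
  K_Lusin kappa E -> A `<=` set_val @` E -> A #= kappa ->
  ~ bounded_on irrational_code A.
Proof.
move=> [_ LE] AE Ak [g Ag].
have [K cK [Kirr HK]] := irrational_code_bounded_compact g.
have [EK nEK] := LE _ (compact_preimage_set_val cK Kirr).
apply: nEK; rewrite card_eq_le EK /=.
rewrite -(card_le_eql Ak).
apply: card_le_trans (card_image_le set_val _); apply: subset_card_le.
move=> x Ax; have [y Ey yx] := AE x Ax; exists y => //; split=> //=.
have yP : unit_irrationals R (set_val y) by exact: set_valP.
by apply: HK => // k; rewrite yx; exact: Ag.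
Qed.

End Irrationals.

(** * Coding sequences of bits by real numbers *)

Section CantorCode.
Context {R : realType}.

(** The sum of [b i / 3 ^ i.+1] over [i < n]. Recursion on the head of [b], rather
    than on the last term, makes [cantor_code_rec] immediate. *)
Fixpoint cantor_sum (n : nat) (b : nat -> bool) : R :=
  if n is n'.+1 then ((b 0)%:R + cantor_sum n' (fun i => b i.+1)) / 3 else 0.

Lemma cantor_sum_itv n b : 0 <= cantor_sum n b <= 1 / 2.
Proof.
elim: n b => [|n IH] b /=; first by apply/andP; split; lra.
have /andP[h1 h2] := IH (fun i => b i.+1).
by case: (b 0) => /=; apply/andP; split; lra.
Qed.

Lemma cantor_sum_nondecreasing b :
  {homo cantor_sum ^~ b : m n / (m <= n)%N >-> m <= n}.
Proof.
move=> m n; elim: n m b => [|n IH] [|m] b //.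
  by move=> _; have /andP[] := cantor_sum_itv n.+1 b.
rewrite ltnS /= => mn; have := IH m (fun i => b i.+1) mn; lra.
Qed.

(** With digits 0 and 1 in base 3, distinct sequences have distinct codes. *)
Definition cantor_code (b : nat -> bool) : R := limn (cantor_sum ^~ b).

Lemma cantor_code_cvg b : cantor_sum n b @[n --> \oo] --> cantor_code b.
Proof.
apply: nondecreasing_is_cvgn; first exact: cantor_sum_nondecreasing.
by exists (1 / 2) => _ [n _ <-]; have /andP[] := cantor_sum_itv n b.
Qed.

Lemma cantor_code_itv b : 0 <= cantor_code b <= 1 / 2.
Proof.
apply/andP; split.
- apply: limr_ge; first exact: (cvgP _ (@cantor_code_cvg b)).
  by apply: nearW => n; have /andP[] := cantor_sum_itv n b.
- apply: limr_le; first exact: (cvgP _ (@cantor_code_cvg b)).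
  by apply: nearW => n; have /andP[] := cantor_sum_itv n b.
Qed.

Lemma cantor_code_rec b :
  cantor_code b = ((b 0)%:R + cantor_code (fun i => b i.+1)) / 3.
Proof.
have h : cantor_sum n.+1 b @[n --> \oo] --> cantor_code b.
  by rewrite (cvg_shiftS (cantor_sum ^~ b)); exact: cantor_code_cvg.
apply: (cvg_unique _ h) => //=; apply: cvgM; last exact: cvg_cst.
by apply: cvgD; [exact: cvg_cst|exact: cantor_code_cvg].
Qed.

(** Each bit is a uniformly locally constant function of the code. *)
Lemma cantor_code_bit i : exists2 delta : R, 0 < delta &
  forall b b', `|cantor_code b - cantor_code b'| < delta -> b i = b' i.
Proof.
have [s s0 Hs] : exists2 s : R, 0 < s &
    forall b b', `|cantor_code b - cantor_code b'| < s -> b 0 = b' 0.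
  exists (1 / 6); first by lra.
  move=> b b'; rewrite (cantor_code_rec b) (cantor_code_rec b').
  have /andP[h1 h2] := cantor_code_itv (fun i => b i.+1).
  have /andP[h3 h4] := cantor_code_itv (fun i => b' i.+1).
  rewrite ltr_norml => /andP[].
  by case: (b 0); case: (b' 0) => //= h5 h6; exfalso; lra.
elim: i => [|i [t t0 IH]]; first by exists s.
exists (Num.min s (t / 3)); first by rewrite lt_min s0; lra.
move=> b b'; rewrite lt_min => /andP[/Hs b0].
rewrite (cantor_code_rec b) (cantor_code_rec b') b0.
rewrite ltr_norml => /andP[h1 h2]; apply: (IH (fun i => b i.+1) (fun i => b' i.+1)).
by rewrite ltr_norml; apply/andP; split; lra.
Qed.

Lemma cantor_code_inj b b' : cantor_code b = cantor_code b' -> b = b'.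
Proof.
move=> bb'; apply/funext => i; have [t t0] := cantor_code_bit i; apply.
by rewrite bb' subrr normr0.
Qed.

End CantorCode.

(** * The Baire space *)

(** A copy of [nat -> nat], carrying the product of the discrete topologies: the
    basic neighbourhoods of [x] are the sets of sequences sharing a prefix with
    [x]. *)
Definition baire : Type := nat -> nat.

HB.instance Definition _ := gen_eqMixin baire.
HB.instance Definition _ := gen_choiceMixin baire.

Definition baire_nbhs (x : baire) : set_system baire :=
  filter_from setT (fun n => [set y : baire | forall i, (i < n)%N -> x i = y i]).

HB.instance Definition _ := hasNbhs.Build baire baire_nbhs.

Lemma baire_nbhs_filter (x : baire) : ProperFilter (nbhs x).
Proof.
apply: filter_from_proper; last by move=> n _; exists x.
apply: filter_from_filter; first by exists 0.
move=> m n _ _; exists (maxn m n) => // y xy; split=> i im; apply: xy;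
  by rewrite leq_max im ?orbT.
Qed.

Lemma baire_nbhs_singleton (x : baire) (A : set baire) : nbhs x A -> A x.
Proof. by case=> n _; apply. Qed.

Lemma baire_nbhs_nbhs (x : baire) (A : set baire) :
  nbhs x A -> nbhs x (nbhs^~ A).
Proof.
case=> n _ nA; exists n => // y xy; exists n => // z yz; apply: nA => i im.
by rewrite xy// yz.
Qed.

HB.instance Definition _ := Nbhs_isNbhsTopological.Build baire
  baire_nbhs_filter baire_nbhs_singleton baire_nbhs_nbhs.

Section BaireMetric.
Context {R : realType}.

Lemma baire_neq_ex (x y : baire) : x <> y -> exists k, x k != y k.
Proof.
move=> xy; apply: contrapT => nk; apply: xy; apply/funext => k.
by apply/eqP; apply: contrapT => /negP kxy; apply: nk; exists k.
Qed.

(** The distance of two distinct sequences is 1/(k+1), where [k] is the first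
    place of disagreement. *)
Definition baire_dist (x y : baire) : R :=
  if pselect (exists k, x k != y k) is left xy then harmonic (ex_minn xy) else 0.

Lemma baire_dist_ge (x y : baire) k : x k <> y k -> harmonic k <= baire_dist x y.
Proof.
move=> /eqP xyk; rewrite /baire_dist; case: pselect => [xy|[]]; last by exists k.
by case: ex_minnP => m _ /(_ _ xyk); exact: harmonic_le.
Qed.

Lemma baire_dist_lt (x y : baire) k :
  baire_dist x y < harmonic k <-> forall i, (i <= k)%N -> x i = y i.
Proof.
split=> [xyk i ik|xyk].
  apply: contrapT => /baire_dist_ge/le_lt_trans/(_ xyk).
  by rewrite ltNge => /negP; apply; exact: harmonic_le.
rewrite /baire_dist; case: pselect => [xy|_]; last exact: harmonic_gt0.
case: ex_minnP => m xym _; rewrite /harmonic ltf_pV2 ?posrE ?ltr0n// ltr_nat ltnS.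
by rewrite ltnNge; apply: contraNN xym => /xyk->.
Qed.

Lemma baire_dist_ge0 x y : 0 <= baire_dist x y.
Proof. by rewrite /baire_dist; case: pselect => // xy; exact: harmonic_ge0. Qed.

Lemma baire_dist_metric : is_metric baire_dist.
Proof.
split.
- exact: baire_dist_ge0.
- move=> x y; split=> [xy0|->].
    apply: contrapT => /baire_neq_ex[k /eqP/baire_dist_ge].
    by rewrite xy0 leNgt harmonic_gt0.
  by rewrite /baire_dist; case: pselect => // h; exfalso; case: h => k; rewrite eqxx.
- move=> x y; rewrite /baire_dist.
  case: pselect => [xy|nxy]; case: pselect => [yx|nyx] //.
  + by congr harmonic; apply: eq_ex_minn => k; rewrite eq_sym.
  + by case: nyx; case: xy => k; rewrite eq_sym; exists k.
  + by case: nxy; case: yx => k; rewrite eq_sym; exists k.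
- move=> x y z; rewrite {1}/baire_dist.
  case: pselect => [xz|_]; last by rewrite addr_ge0// baire_dist_ge0.
  case: ex_minnP => m xzm _.
  have [xym|/eqP xym] := eqVneq (x m) (y m).
    rewrite xym in xzm; move/eqP: xzm => /baire_dist_ge h.
    by apply: le_trans h _; rewrite lerDr baire_dist_ge0.
  by apply: le_trans (baire_dist_ge xym) _; rewrite lerDl baire_dist_ge0.
Qed.

Lemma baire_dist_compatible : compatible_metric baire_dist.
Proof.
move=> x A; split=> [[n _ nA]|[e e0 eA]].
  exists (harmonic n); first exact: harmonic_gt0.
  by move=> y /baire_dist_lt xy; apply: nA => i /ltnW; exact: xy.
have [k ke] := ex_harmonic_lt e0; exists k.+1 => // y xy; apply: eA => /=.
by apply: lt_trans ke; apply/baire_dist_lt => i ik; exact: xy.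
Qed.

Lemma baire_dist_complete : complete_metric baire_dist.
Proof.
move=> u uC.
have /choice[N HN] : forall k, exists N, forall m n,
    (N <= m)%N -> (N <= n)%N -> u m k = u n k.
  move=> k; have [N HN] := uC (harmonic k) (harmonic_gt0 k); exists N => m n Nm Nn.
  by have /baire_dist_lt := HN m n Nm Nn; exact.
exists (fun k => u (N k) k); apply/ge0_cvg0P.
  by move=> n; exact: baire_dist_ge0.
move=> e e0; have [k ke] := ex_harmonic_lt e0.
exists (\max_(i < k.+1) N i)%N => n Nn.
apply: lt_trans ke; apply/baire_dist_lt => i ik.
apply: HN => //; apply: leq_trans Nn.
exact: (@leq_bigmax _ (fun i : 'I_k.+1 => N i) (Ordinal (ik : (i < k.+1)%N))).
Qed.

Lemma baire_polish : polish_space R baire.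
Proof.
split.
  exists baire_dist; split; [exact: baire_dist_metric|exact: baire_dist_compatible|].
  exact: baire_dist_complete.
(* The eventually zero sequences are dense. *)
exists (range (nth 0 : seq nat -> baire)).
  by apply: card_le_trans (card_image_le _ _) _; exact: countableP.
move=> O [x Ox] oO; have [n _ nO] : nbhs x O by exact: open_nbhs_nbhs.
exists (nth 0 (mkseq x n)); split; last by exists (mkseq x n).
by apply: nO => i ik; rewrite nth_mkseq.
Qed.

End BaireMetric.

Lemma baire_compact_bounded (K : set baire) (i : nat) : compact K ->
  exists b, forall x, K x -> (x i <= b)%N.
Proof.
move=> cK; apply: contrapT => nb.
have /choice[u Hu] : forall n, exists x, K x /\ (n < x i)%N.
  move=> n; apply: contrapT => nx; apply: nb; exists n => x Kx.
  by rewrite leqNgt; apply/negP => ?; apply: nx; exists x.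
have [|p [_ clp]] := cK (u @ \oo) _; first by exists 0 => // n _; case: (Hu n).
have [||_ [[n pn <-] pu]] := clp (u @` [set n | (p i <= n)%N])
  [set y : baire | forall j, (j < i.+1)%N -> p j = y j].
- by exists (p i) => // n /= pn; exists n.
- by exists i.+1.
by have [_] := Hu n; rewrite -(pu i (ltnSn i)) ltnNge pn.
Qed.

Lemma baire_not_sigma_compact : ~ sigma_compact baire.
Proof.
move=> [K cK KT].
have /choice[b Hb] : forall n, exists b, forall x, K n x -> (x n <= b)%N.
  by move=> n; exact: baire_compact_bounded.
have : [set: baire] (fun n => (b n).+1) by [].
by rewrite -KT => -[n _ /Hb]; rewrite ltnn.
Qed.

(** * Uniform convergence and oscillation *)

Lemma uniform_cvgP {R : realType} (A : set R) (f_ : nat -> R -> R) (g : R -> R) :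
  {uniform A, f_ @ \oo --> g} <->
  forall e, 0 < e -> exists N, forall n, (N <= n)%N ->
    forall x, A x -> `|g x - f_ n x| < e.
Proof.
split=> [fg e e0|H].
  have : nbhs (g : {uniform` A -> R}) [set h | forall x, A x -> `|g x - h x| < e].
    apply/uniform_nbhs; exists [set xy | ball xy.1 e xy.2]; split=> //.
    exact: (entourage_ball _ (PosNum e0)).
  by move=> /fg[N _ HN]; exists N => n Nn; exact: HN.
move=> P /uniform_nbhs[E [+ EP]]; rewrite -entourage_from_ballE => -[e e0 eE].
have [N HN] := H e e0; exists N => // n Nn; apply: EP => x Ax; apply: eE.
exact: HN.
Qed.

(** The oscillation of [f] at [x] within [E] at scale 1/(n+1). It is truncated at
    1 so that the supremum is that of a bounded set. *)
Definition local_oscillation {R : realType} {Y : Type} (d : Y -> Y -> R)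
    (E : set R) (f : R -> Y) (n : nat) (x : R) : R :=
  sup [set Num.min 1 (d (f x) (f y)) | y in [set y | E y /\ `|x - y| < harmonic n]].

Section Oscillation.
Context {R : realType} {Y : topologicalType} (d : Y -> Y -> R).
Hypothesis cd : complete_compatible_metric d.
Variables (E : set R) (f : R -> Y).

Local Notation osc := (local_oscillation d E f).

Lemma le_local_oscillation n x y : E y -> `|x - y| < harmonic n ->
  Num.min 1 (d (f x) (f y)) <= osc n x.
Proof.
move=> Ey xy; apply: ub_le_sup; last by exists y.
by exists 1 => _ [z _ <-]; rewrite ge_min lexx.
Qed.

Lemma local_oscillation_le n x t : E x ->
  (forall y, E y -> `|x - y| < harmonic n -> d (f x) (f y) <= t) -> osc n x <= t.
Proof.
move=> Ex H; apply: ge_sup.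
  exists (Num.min 1 (d (f x) (f x))), x => //; split=> //.
  by rewrite subrr normr0 harmonic_gt0.
by move=> _ [y [Ey xy] <-]; rewrite ge_min H ?orbT.
Qed.

Lemma local_oscillation_ge0 n x : E x -> 0 <= osc n x.
Proof.
move=> Ex; have := @le_local_oscillation n x x Ex.
rewrite subrr normr0 harmonic_gt0 => /(_ isT); apply: le_trans.
by case: cd => -[dge0 _ _ _] _ _; rewrite le_min ler01 dge0.
Qed.

Lemma local_oscillation_cvg0 x : {within E, continuous f} -> E x ->
  osc n x @[n --> \oo] --> 0.
Proof.
move=> /subspace_continuousP fc Ex; apply/ge0_cvg0P.
  by move=> n; exact: local_oscillation_ge0.
move=> e e0; have e20 : 0 < e / 2 by lra.
have : nbhs (f x) [set z | d (f x) z < e / 2].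
  by apply/(nbhs_metricP cd); exists (e / 2).
move=> /(fc x Ex)/nbhs_ballP[t t0 Ht]; have [N Nt] := ex_harmonic_lt t0.
exists N => n Nn; apply: (@le_lt_trans _ _ (e / 2)); last by lra.
apply: local_oscillation_le => // y Ey xy; apply/ltW/Ht => //.
by apply: lt_trans xy (le_lt_trans _ Nt); exact: harmonic_le.
Qed.

Lemma uniform_local_oscillation_unif_continuous (A : set R) (g : R -> R) :
  {within E, continuous f} -> A `<=` E ->
  {uniform A, osc @ \oo --> g} -> unif_continuous_on d A f.
Proof.
move=> fc AE /uniform_cvgP og e e0.
pose t : R := Num.min 1 e / 3.
have t0 : 0 < t by rewrite divr_gt0// lt_min ltr01.
have [N HN] := og t t0; exists (harmonic N); first exact: harmonic_gt0.
move=> x y Ax Ay xy.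
(* The uniform limit [g] is eliminated by comparison with an index [M] from which
   on the oscillation at [x] is small. *)
have [M HM] := (ge0_cvg0P (fun n => local_oscillation_ge0 n (AE x Ax))).1
  (local_oscillation_cvg0 fc (AE x Ax)) t t0.
have oM := HM _ (leq_maxr N M).
have := HN _ (leq_maxl N M) x Ax; have := HN _ (leqnn N) x Ax.
rewrite !ltr_norml => /andP[h1 h2] /andP[h3 h4].
have : Num.min 1 (d (f x) (f y)) < Num.min 1 e.
  apply: le_lt_trans (le_local_oscillation (AE y Ay) xy) _.
  have -> : Num.min 1 e = t * 3 by rewrite divfK.
  lra.
by rewrite lt_min !gt_min ltxx /= => /andP[d1 /orP[e1|//]]; exact: lt_trans d1 e1.
Qed.

End Oscillation.

Lemma C9_of_nowhere_unif_continuous {R : realType} {kT lT : Type}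
    (kappa : set kT) (lambda : set lT) (E : set R) (Y : topologicalType) :
  E #= lambda -> polish_space R Y -> has_nowhere_unif_continuous_map kappa E Y ->
  C9 R lambda kappa.
Proof.
move=> El [[d cd] _] [f [fc nf]]; exists E; split=> //.
exists (local_oscillation d E f); split=> [x Ex|A AE Ak [g og]].
  exact: (cvgP _ (local_oscillation_cvg0 cd fc Ex)).
exact: (nf d cd A AE Ak (uniform_local_oscillation_unif_continuous cd fc AE og)).
Qed.

(** * From pointwise convergence to continuous maps *)

(** Every [phi] becomes continuous after [E] is moved by a suitable injection [c]:
    the digits of [c x] spell both [x], for injectivity, and the graph of
    [phi x]. *)
Lemma continuous_coding {R : realType} (E : set R) (phi : R -> nat -> nat) :
  E #<= [set: nat -> bool] ->
  exists c : R -> R, [/\ {in E &, injective c}, c @` E `<=` `[0, 1] &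
    forall psi : R -> nat -> nat, (forall x, E x -> psi (c x) = phi x) ->
      coordinatewise_locally_constant (c @` E) psi].
Proof.
move=> /pcard_injP[j jinj].
pose code := (nat + nat * nat)%type.
pose b (x : R) (i : nat) : bool :=
  match @unpickle code i with
  | Some (inl m) => j x m
  | Some (inr (k, n)) => phi x k == n
  | None => false
  end.
exists (fun x => cantor_code (b x)); split.
- move=> x y Ex Ey /cantor_code_inj bxy; apply: jinj => //.
  apply/funext => m; have := congr1 (@^~ (pickle (inl m : code))) bxy.
  by rewrite /= /b pickleK.
- move=> _ [x _ <-]; rewrite /= in_itv /=.
  have /andP[h1 h2] := cantor_code_itv (R := R) (b x); apply/andP; split; lra.
- move=> psi psic _ k [x Ex <-].
  have [t t0 Ht] := @cantor_code_bit R (pickle (inr (k, phi x k) : code)).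
  exists t => // _ [y Ey <-] /Ht; rewrite /b pickleK eqxx => /esym/eqP.
  by rewrite !psic.
Qed.

Lemma nowhere_unif_continuous_of_C9 {R : realType} {kT lT : Type}
    (kappa : set kT) (lambda : set lT) :
  lambda #<= [set: nat -> bool] -> C9 R lambda kappa ->
  exists E : set R, E #= lambda /\ has_nowhere_unif_continuous_map kappa E baire.
Proof.
move=> lc [E [El [f_ [fc nfu]]]].
(* [phi x] is a modulus of convergence at [x]. *)
have /choice[phi Hphi] : forall x, exists p : nat -> nat, E x -> forall k n,
    (p k <= n)%N -> `|limn (f_ ^~ x) - f_ n x| < harmonic k.
  move=> x; have [Ex|nEx] := pselect (E x); last by exists (fun=> 0%N).
  have /choice[p Hp] : forall k, exists N, forall n,
      (N <= n)%N -> `|limn (f_ ^~ x) - f_ n x| < harmonic k.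
    move=> k; have /cvgrPdist_lt/(_ _ (harmonic_gt0 k))[N _ HN] := fc x Ex.
    by exists N => n Nn; exact: HN.
  by exists p => _ k n; exact: Hp.
have Ec : E #<= [set: nat -> bool] by rewrite (card_le_eql El).
have [c [cinj c01 clc]] := continuous_coding phi Ec.
have /choice[inv Hinv] : forall t, exists x, (c @` E) t -> E x /\ c x = t.
  move=> t; have [[x Ex xt]|nt] := pselect ((c @` E) t); first by exists x.
  by exists 0 => /nt.
have invc x : E x -> inv (c x) = x.
  move=> Ex; have [|Ex' cx] := Hinv (c x); first by exists x.
  by apply: cinj => //; rewrite inE.
exists (c @` E); split; first exact: card_eq_trans (inj_card_eq cinj) El.
apply: (@nowhere_unif_continuous_of_unbounded _ _ _ _ (phi \o inv)) => //.
- by apply: clc => x Ex /=; rewrite invc.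
- move=> A AcE Ak [g Hg].
  apply: (nfu (inv @` A)).
  + by move=> _ [t At <-]; case: (Hinv t (AcE t At)).
  + apply: card_eq_trans (inj_card_eq _) Ak => s t; rewrite !inE => As At st.
    by rewrite -(Hinv s (AcE s As)).2 st (Hinv t (AcE t At)).2.
  exists (fun x => limn (f_ ^~ x)); apply/uniform_cvgP => e e0.
  have [k ke] := ex_harmonic_lt e0; exists (g k) => n gn _ [t At <-].
  apply: lt_trans ke; apply: Hphi; first by case: (Hinv t (AcE t At)).
  exact: leq_trans (Hg t k At) gn.
- exact: baire_polish.
- exact: baire_not_sigma_compact.
Qed.

(** * The equivalence *)

Theorem theorem2p2 (R : realType) (kT lT : Type)
    (kappa : set kT) (lambda : set lT)
    (kappa_uncountable : ~ countable kappa)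
    (lambda_uncountable : ~ countable lambda)
    (kappa_le_lambda : kappa #<= lambda)
    (lambda_le_continuum : lambda #<= [set: nat -> bool]) :
  (C9 R lambda kappa <->
   exists (E : set R) (Y : topologicalType),
     [/\ E #= lambda, polish_space R Y, ~ sigma_compact Y
       & has_nowhere_unif_continuous_map kappa E Y])
  /\
  (forall E : set (set_type (unit_irrationals R)),
     K_Lusin kappa E -> E #= lambda ->
     forall Y : topologicalType, polish_space R Y -> ~ sigma_compact Y ->
       has_nowhere_unif_continuous_map kappa (set_val @` E) Y).
Proof.
split; first split.
- move=> /(nowhere_unif_continuous_of_C9 lambda_le_continuum)[E [El Ef]].
  by exists E, baire; split=> //; [exact: baire_polish|exact: baire_not_sigma_compact].
- by move=> [E [Y [El pY _ Ef]]]; exact: C9_of_nowhere_unif_continuous El pY Ef.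
- move=> E LE _ Y pY nsY.
  have EP : set_val @` E `<=` unit_irrationals R.
    by move=> _ [y _ <-]; exact: set_valP.
  apply: (@nowhere_unif_continuous_of_unbounded _ _ _ _ irrational_code) => //.
  + by move=> x /EP[].
  + by apply: irrational_code_locally_constant => x /EP[].
  + by move=> A AE Ak; exact: K_Lusin_code_unbounded LE AE Ak.
Qed.
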